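(* Let $\mathcal A\in\mathcal P(\mathcal P(\mathbb N))$ and $D\subseteq\mathbb N$. If $\mathcal A\le_{\mathrm{lo}}\rho_D$, then $\mathcal A\cong_{\mathrm{lo}}\{\}$, where $\{\}$ is the empty collection.
   Context: Write $e(n)$ for the (possibly undefined) value at $n$ of the $e$-th partial recursive function, and $\langle\cdot,\cdot\rangle$ for a fixed recursive bijective pairing on $\mathbb{N}$. $\mathcal P(X)$ is the power set. For $A,B\subseteq\mathbb{N}$ put $A\Rightarrow B=\{e : \text{for all } a\in A,\ e(a)\text{ is defined and } e(a)\in B\}$ and $A\wedge B=\{\langle a,b\rangle : a\in A, b\in B\}$. For $h,k:\mathcal P(\mathbb N)\to\mathcal P(\mathbb N)$ write $h\le k$ if $\bigcap_{p\subseteq\mathbb N}(h(p)\Rightarrow k(p))\ne\emptyset$. A local operator (Lawvere–Tierney topology) on the effective topos $\mathbf{Eff}$ is represented by a function $j:\mathcal P(\mathbb N)\to\mathcal P(\mathbb N)$ such that $\bigcap_p(p\Rightarrow j(p))$, $\bigcap_{p,q}(j(p\Rightarrow q)\Rightarrow(j(p)\Rightarrow j(q)))$ and $\bigcap_p(j(j(p))\Rightarrow j(p))$ are non-empty; local operators are ordered by $\le$ (functions $j,k$ with $j\le k\le j$ representing the same one). For $\theta:\mathbb N\to\mathcal P(\mathcal P(\mathbb N))$ put $\mathrm{mo}_\theta(p)=\{\langle n,e\rangle : \exists A\in\theta(n),\ e\in(A\Rightarrow p)\}$, and let $\mathrm{lo}_\theta$ be the least local operator $j$ with $\mathrm{mo}_\theta\le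 j$; it is represented by $\mathrm{lo}_\theta(p)=\bigcap_{q\subseteq\mathbb N}\big(((\mathrm{mo}_\theta(q)\Rightarrow q)\wedge(p\Rightarrow q))\Rightarrow q\big)$. Write $\eta\le_{\mathrm{lo}}\theta$ if $\mathrm{lo}_\eta\le\mathrm{lo}_\theta$, and $\eta\cong_{\mathrm{lo}}\theta$ if $\eta\le_{\mathrm{lo}}\theta$ and $\theta\le_{\mathrm{lo}}\eta$. A collection $\mathcal A\in\mathcal P(\mathcal P(\mathbb N))$ is identified with the constant function $\mathbb N\to\mathcal P(\mathcal P(\mathbb N))$ with value $\mathcal A$. (The empty collection gives the least local operator $\mathrm{id}$.) For $D\subseteq\mathbb N$, $\rho_D:\mathbb N\to\mathcal P(\mathcal P(\mathbb N))$ is defined by $\rho_D(n)=\{\{0\}\}$ if $n\in D$ and $\rho_D(n)=\{\{1\}\}$ otherwise; it gives the Turing degree topology of $D$. *)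

(* Defs.v *)
From mathcomp Require Import all_boot boolp classical_sets.
From Stdlib Require Cantor.

Set Implicit Arguments.
Unset Strict Implicit.
Unset Printing Implicit Defensive.

Local Open Scope classical_set_scope.

(* The Cantor pairing, a primitive recursive bijection from nat * nat to nat *)
Definition pairn (a b : nat) : nat := Cantor.to_nat (a, b).
Definition fstn (x : nat) : nat := (Cantor.of_nat x).1.
Definition sndn (x : nat) : nat := (Cantor.of_nat x).2.

(* Kleene's schemes for the unary partial recursive functions. Functions of    *)
(* several arguments are unary functions of a paired argument, so that pairing *)
(* and its projections play the role of the projections of arity n.            *)
Inductive code : Type :=
| Zero
| Succ
| Fst
| Snd
| Pair of code & code
| Comp of code & code
| Prec of code & code
| Mu of code.

(* [eval c x y]: the function described by c is defined at x, with value y.   *)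
(* Mu f maps x to the least y with f <x, y> = 0, provided that f <x, m> is     *)
(* defined for every m < y.                                                   *)
Fixpoint eval (c : code) (x y : nat) {struct c} : Prop :=
  match c with
  | Zero => y = 0
  | Succ => y = x.+1
  | Fst => y = fstn x
  | Snd => y = sndn x
  | Pair f g => exists a b, [/\ eval f x a, eval g x b & y = pairn a b]
  | Comp f g => exists2 a, eval g x a & eval f a y
  | Prec f g =>
      (fix rec (n z : nat) {struct n} : Prop :=
         match n with
         | 0 => eval f (fstn x) z
         | m.+1 => exists2 w, rec m w & eval g (pairn (fstn x) (pairn m w)) z
         end) (sndn x) y
  | Mu f => eval f (pairn x y) 0 /\
            (forall m, m < y -> exists k, eval f (pairn x m) k.+1)
  end.

Fixpoint encode (c : code) : nat :=
  match c with
  | Zero => pairn 0 0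
  | Succ => pairn 1 0
  | Fst => pairn 2 0
  | Snd => pairn 3 0
  | Pair f g => pairn 4 (pairn (encode f) (encode g))
  | Comp f g => pairn 5 (pairn (encode f) (encode g))
  | Prec f g => pairn 6 (pairn (encode f) (encode g))
  | Mu f => pairn 7 (encode f)
  end.

(* [papp e n y]: the e-th partial recursive function is defined at n, with      *)
(* value y. A number that encodes no code is an index of the nowhere defined  *)
(* function.                                                                  *)
Definition papp (e n y : nat) : Prop :=
  exists2 c, encode c = e & eval c n y.

Lemma pairn_inj a b a' b' : pairn a b = pairn a' b' -> a = a' /\ b = b'.
Proof. by move=> /Cantor.to_nat_inj [-> ->]. Qed.

Lemma encode_inj : injective encode.
Proof.
elim=> [||||f IHf g IHg|f IHf g IHg|f IHf g IHg|f IHf]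
       [||||f' g'|f' g'|f' g'|f'] //= /pairn_inj [] //= _.
- by move=> /pairn_inj [/IHf -> /IHg ->].
- by move=> /pairn_inj [/IHf -> /IHg ->].
- by move=> /pairn_inj [/IHf -> /IHg ->].
- by move=> /IHf ->.
Qed.

Lemma eval_functional c x y y' : eval c x y -> eval c x y' -> y = y'.
Proof.
elim: c x y y' => [||||f IHf g IHg|f IHf g IHg|f IHf g IHg|f IHf] x y y' /=.
- by move=> -> ->.
- by move=> -> ->.
- by move=> -> ->.
- by move=> -> ->.
- move=> [a [b [fa gb ->]]] [a' [b' [fa' gb' ->]]].
  by rewrite (IHf _ _ _ fa fa') (IHg _ _ _ gb gb').
- move=> [a ga fy] [a' ga' fy'].
  by move: fy'; rewrite -(IHg _ _ _ ga ga'); exact: IHf fy.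
- elim: (sndn x) y y' => [|n IHn] y y'; first exact: IHf.
  move=> [w rw gy] [w' rw' gy'].
  by move: gy'; rewrite -(IHn _ _ rw rw'); exact: IHg gy.
- move=> [f0 fS] [f0' fS']; case: (ltngtP y y') => // lt_y.
    by have [k fk] := fS' _ lt_y; have := IHf _ _ _ f0 fk.
  by have [k fk] := fS _ lt_y; have := IHf _ _ _ f0' fk.
Qed.

Lemma papp_functional e n y y' : papp e n y -> papp e n y' -> y = y'.
Proof.
by move=> [c <- cy] [c' /encode_inj -> cy']; exact: eval_functional cy cy'.
Qed.

Definition imp (A B : set nat) : set nat :=
  [set e | forall a, A a -> exists2 b, papp e a b & B b].

Definition wedge (A B : set nat) : set nat :=
  [set pairn a b | a in A & b in B].

Definition le_op (h k : set nat -> set nat) : Prop :=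
  \bigcap_(p in [set: set nat]) imp (h p) (k p) !=set0.

Definition mo (theta : nat -> set (set nat)) (p : set nat) : set nat :=
  [set x | exists n e,
     x = pairn n e /\ exists2 A, theta n A & imp A p e].

(* Up to the preorder [le_op], [lo theta] is the least local operator above    *)
(* [mo theta]; this is its impredicative description.                         *)
Definition lo (theta : nat -> set (set nat)) (p : set nat) : set nat :=
  \bigcap_(q in [set: set nat]) imp (wedge (imp (mo theta q) q) (imp p q)) q.

Definition le_lo (eta theta : nat -> set (set nat)) : Prop :=
  le_op (lo eta) (lo theta).

Definition equiv_lo (eta theta : nat -> set (set nat)) : Prop :=
  le_lo eta theta /\ le_lo theta eta.

Definition rho (D : set nat) (n : nat) : set (set nat) :=
  if n \in D then [set [set 0]] else [set [set 1]].

(* Main.v *)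
(* The oracle [rho D] answers each query with a single number, so a realizer   *)
(* of [lo (rho D) S] describes an interaction with the oracle that ends in at  *)
(* most one number, which depends on D but not on S. A realizer of             *)
(* [A <=_lo rho D] gives one such interaction that works for all S in A, so    *)
(* its outcome m lies in every S in A. Evaluation at m then maps [mo A q] to q *)
(* for all q, which makes A trivial.                                           *)

Require Import Defs.
From mathcomp Require Import all_boot boolp classical_sets.
From Stdlib Require Cantor.

Local Open Scope classical_set_scope.

(** Everything rests on uniformity. A single number lies in [lo] of [A] at every S in [A]
    ([lo_unit]), and the realizer of the hypothesis sends it to a single z in [lo (rho D) S] for all
    these S. Each query has exactly one possible answer, so following z involves no choice and ends
    in one m common to all S ([lo_rho_common]). Then <n, e> |-> e(m) realizes [mo] of [A] at q
    implies q, for every q, so [A] adds nothing to the empty collection ([common_le_lo_set0]).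
    Evaluating an index received as input takes [universal_code], which comes from a stack
    machine. *)

Lemma fstn_pairn a b : fstn (pairn a b) = a.
Proof. by rewrite /fstn /pairn Cantor.cancel_of_to. Qed.

Lemma sndn_pairn a b : sndn (pairn a b) = b.
Proof. by rewrite /sndn /pairn Cantor.cancel_of_to. Qed.

Lemma pairnK x : pairn (fstn x) (sndn x) = x.
Proof. by rewrite /pairn /fstn /sndn -surjective_pairing Cantor.cancel_to_of. Qed.

Definition pairnE := (fstn_pairn, sndn_pairn).

(** * Total computable functions *)

Definition computable (f : nat -> nat) : Prop :=
  exists c, forall x, eval c x (f x).

Lemma computable_ext f g : f =1 g -> computable f -> computable g.
Proof. by move=> fg [c cP]; exists c => x; rewrite -fg. Qed.

Lemma computable_id : computable id.
Proof.
by exists (Pair Fst Snd) => x /=; exists (fstn x), (sndn x); rewrite pairnK.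
Qed.

Lemma computable_comp f g :
  computable f -> computable g -> computable (fun x => f (g x)).
Proof. by move=> [c cP] [d dP]; exists (Comp c d) => x; exists (g x). Qed.

Lemma computable_succ f : computable f -> computable (fun x => (f x).+1).
Proof. by apply: computable_comp; exists Succ. Qed.

Lemma computable_const n : computable (fun=> n).
Proof. by elim: n => [|n /computable_succ //]; exists Zero. Qed.

Lemma computable_fst f : computable f -> computable (fun x => fstn (f x)).
Proof. by apply: computable_comp; exists Fst. Qed.

Lemma computable_snd f : computable f -> computable (fun x => sndn (f x)).
Proof. by apply: computable_comp; exists Snd. Qed.

Lemma computable_pair f g :
  computable f -> computable g -> computable (fun x => pairn (f x) (g x)).
Proof.
by move=> [c cP] [d dP]; exists (Pair c d) => x /=; exists (f x), (g x).
Qed.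

Lemma computable_iter f g n : computable f -> computable g -> computable n ->
  computable (fun x => iter (n x) f (g x)).
Proof.
move=> [c cP] cg cn.
suff: computable (fun x => iter (sndn x) f (fstn x)).
  move=> /computable_comp /(_ (computable_pair _ _ cg cn)).
  by apply: computable_ext => x; rewrite !pairnE.
have [d dP] := computable_id.
exists (Prec d (Comp c (Comp Snd Snd))) => x /=.
elim: (sndn x) => [|k IHk]; first exact: dP.
exists (iter k f (fstn x)) => //; exists (iter k f (fstn x)); last exact: cP.
by exists (pairn k (iter k f (fstn x))); rewrite pairnE.
Qed.

Lemma computable_if0 t f g : computable t -> computable f -> computable g ->
  computable (fun x => if t x is 0 then f x else g x).
Proof.
move=> ct [c cP] [d dP].
suff: computable (fun x => if sndn x is 0 then f (fstn x) else g (fstn x)).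
  move=> /computable_comp /(_ (computable_pair _ _ computable_id ct)).
  by apply: computable_ext => x; rewrite !pairnE.
exists (Prec c (Comp d Fst)) => x /=.
elim: (sndn x) => [|k IHk]; first exact: cP.
by eexists; [exact: IHk | exists (fstn x); rewrite ?pairnE].
Qed.

Lemma computable_pred f : computable f -> computable (fun x => (f x).-1).
Proof.
apply: computable_comp.
suff: computable (fun x => (sndn x).-1).
  move=> /computable_comp /(_ (computable_pair _ _ computable_id computable_id)).
  by apply: computable_ext => x; rewrite pairnE.
exists (Prec Zero (Comp Fst Snd)) => x /=.
elim: (sndn x) => [|k IHk] //=.
by exists k.-1 => //; exists (pairn k k.-1); rewrite !pairnE.
Qed.

Lemma computable_nth_nil t : computable (fun x => nth 0 [::] (t x)).
Proof.
by apply: computable_ext (computable_const 0) => x; rewrite nth_nil.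
Qed.

Lemma computable_nth_cons t h l : computable t -> computable h ->
  computable (fun x => nth 0 (l x) (t x).-1) ->
  computable (fun x => nth 0 (h x :: l x) (t x)).
Proof.
move=> ct ch cl; apply: computable_ext (computable_if0 _ _ _ ct ch cl) => x.
by case: (t x).
Qed.

(** * A universal code *)

(* A state is the pair of the current value and of a stack of instructions,    *)
(* each of which is to be applied to the value left by the previous one.       *)
Definition push (i l : nat) : nat := (pairn i l).+1.

(* Tags 0 to 7 are those of [encode]. The others are continuations:            *)
(* <8, <g, x>> evaluates g at x, once the first component is known, which      *)
(* <9, a>, with that component a, pairs with the result; <10, <g, <x, m>>>     *)
(* does a step of a primitive recursion; and <11, <f, <x, y>>> inspects the    *)
(* value of f at <x, y> in an unbounded search.                                *)
Definition step (s : nat) : nat :=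
  let v := fstn s in
  let i := fstn (sndn s).-1 in
  let l := sndn (sndn s).-1 in
  let u := sndn i in
  let f := fstn u in
  let g := sndn u in
  if sndn s is 0 then s else
  nth 0 [::
    pairn 0 l;
    pairn v.+1 l;
    pairn (fstn v) l;
    pairn (sndn v) l;
    pairn v (push f (push (pairn 8 (pairn g v)) l));
    pairn v (push g (push f l));
    if sndn v is 0 then pairn (fstn v) (push f l) else
      let w := pairn (fstn v) (sndn v).-1 in
      pairn w (push i (push (pairn 10 (pairn g w)) l));
    let w := pairn v 0 in pairn w (push u (push (pairn 11 (pairn u w)) l));
    pairn g (push f (push (pairn 9 v) l));
    pairn (pairn u v) l;
    pairn (pairn (fstn g) (pairn (sndn g) v)) (push f l);
    if v is 0 then pairn (sndn g) l else
      let w := pairn (fstn g) (sndn g).+1 in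
      pairn w (push f (push (pairn 11 (pairn f w)) l))
  ] (fstn i).

Lemma computable_step : computable step.
Proof.
rewrite /step /push /=.
repeat first [ apply: computable_id | apply: computable_if0
  | apply: computable_nth_cons | apply: computable_nth_nil
  | apply: computable_const | apply: computable_pair | apply: computable_succ
  | apply: computable_pred | apply: computable_fst | apply: computable_snd ].
Qed.

Definition reach (s s' : nat) : Prop := exists n, iter n step s = s'.

Lemma reach_refl s : reach s s.
Proof. by exists 0. Qed.

Lemma reach_trans s s' s'' : reach s s' -> reach s' s'' -> reach s s''.
Proof. by move=> [n <-] [m <-]; exists (m + n); rewrite iterD. Qed.

Lemma reach_step s s' : reach (step s) s' -> reach s s'.
Proof. by move=> [n <-]; exists n.+1; rewrite iterSr. Qed.

(** Induction on c with l arbitrary, so that the continuations of a compound code can lie below its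
    subcodes on the stack. *)
Lemma reach_eval c x y l :
  eval c x y -> reach (pairn x (push (encode c) l)) (pairn y l).
Proof.
elim: c x y l => [||||f IHf g IHg|f IHf g IHg|f IHf g IHg|f IHf] x y l /= E;
  apply: reach_step; rewrite /step /push !pairnE /= ?pairnE /=.
- by rewrite E; exact: reach_refl.
- by rewrite E; exact: reach_refl.
- by rewrite E; exact: reach_refl.
- by rewrite E; exact: reach_refl.
- have [a [b [fa gb ->]]] := E.
  apply: reach_trans (IHf _ _ _ fa) _; apply: reach_step.
  rewrite /step /push !pairnE /= ?pairnE /=.
  apply: reach_trans (IHg _ _ _ gb) _; apply: reach_step.
  by rewrite /step /push !pairnE /= ?pairnE /=; exact: reach_refl.
- have [a ga fy] := E.
  exact: reach_trans (IHg _ _ _ ga) (IHf _ _ _ fy).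
- elim: (sndn x) y l E => [|m IHm] y l; first exact: IHf.
  move=> [w rw gy] /=.
  apply: reach_trans (_ : reach _ (pairn w _)) _.
    apply: reach_step; rewrite /step /push !pairnE /= ?pairnE /=.
    exact: IHm rw.
  apply: reach_step; rewrite /step /push !pairnE /= ?pairnE /=.
  exact: IHg.
- have [f0 fS] := E.
  (* Here k counts the candidates still to be rejected before y. *)
  suff search k m : m + k = y ->
      reach (pairn (pairn x m) (push (encode f)
               (push (pairn 11 (pairn (encode f) (pairn x m))) l)))
            (pairn y l).
    exact: (search y 0).
  elim: k m => [|k IHk] m; rewrite ?addn0 ?addnS => my.
    rewrite my; apply: reach_trans (IHf _ _ _ f0) _.
    by apply: reach_step; rewrite /step /push !pairnE /= ?pairnE /=; exact: reach_refl.
  have [j fm] := fS m ltac:(by rewrite -my ltnS leq_addr).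
  apply: reach_trans (IHf _ _ _ fm) _.
  apply: reach_step; rewrite /step /push !pairnE /= ?pairnE /=.
  by apply: IHk; rewrite addSn.
Qed.

Lemma step_halted s n : sndn s = 0 -> iter n step s = s.
Proof. by move=> s0; elim: n => //= n ->; rewrite /step s0. Qed.

(** [Mu] finds the first stage with an empty stack, coded by 0. Halted states are fixed by [step],
    so that stage already carries the final value. *)
Lemma universal_code :
  exists u, forall e x y, papp e x y -> eval u (pairn e x) y.
Proof.
pose start w := pairn (sndn w) (push (fstn w) 0).
pose run w := iter (sndn w) step (start (fstn w)).
have crun : computable run.
  apply: computable_iter computable_step _ _; rewrite /start /push;
  by repeat first [ apply: computable_id | apply: computable_const
    | apply: computable_pair | apply: computable_succ
    | apply: computable_fst | apply: computable_snd ].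
have [r rP] := computable_fst _ crun.
have [h hP] := computable_snd _ crun.
have [i iP] := computable_id.
exists (Comp r (Pair i (Mu h))) => e x y [c <- cxy].
set w := pairn _ x.
have [N runN] : reach (start w) (pairn y 0).
  by rewrite /start !pairnE; exact: reach_eval.
have haltN : exists n, sndn (run (pairn w n)) == 0.
  by exists N; rewrite /run !pairnE runN pairnE.
have [n /eqP haltn minn] := find_ex_minn haltN.
have runn : run (pairn w n) = pairn y 0.
  have leN : n <= N by apply: minn; rewrite /run !pairnE runN pairnE.
  rewrite -runN -(subnK leN) iterD.
  by move: haltn; rewrite /run !pairnE => /step_halted ->.
exists (pairn w n); last by rewrite -(fstn_pairn y 0) -runn; exact: rP.
exists w, n; split=> //; split; first by rewrite -haltn; exact: hP.
move=> m ltmn; exists (sndn (run (pairn w m))).-1.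
rewrite prednK; first exact: hP.
by rewrite lt0n; apply: contraL ltmn => /minn; rewrite -leqNgt.
Qed.

(** * Collections below a Turing degree topology *)

Lemma papp_encode c x y : eval c x y -> papp (encode c) x y.
Proof. by exists c. Qed.

(* The interaction with an oracle chi that is described by a number and ends   *)
(* with value y: <0, y> returns y, and <1, <n, e>> continues with e(chi(n)).   *)
Inductive outcome (chi : nat -> nat) : nat -> nat -> Prop :=
| outcome_return y : outcome chi (pairn 0 y) y
| outcome_query n e x y : papp e (chi n) x -> outcome chi x y ->
    outcome chi (pairn 1 (pairn n e)) y.

Lemma outcome_functional chi x y y' :
  outcome chi x y -> outcome chi x y' -> y = y'.
Proof.
move=> xy; elim: xy y' => {x y} [y|n e x y ex _ IH] y' xy'.
  by case E: _ _ / xy' => [z|n e x z _ _]; have [] := pairn_inj E.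
case E: _ _ / xy' => [z|n' e' x' z ex' xz]; first by have [] := pairn_inj E.
have [_ /pairn_inj [En Ee]] := pairn_inj E; subst n' e'.
by apply: IH; rewrite (papp_functional ex ex').
Qed.

Lemma rho_eq D n : rho D n = [set [set nat_of_bool (n \notin D)]].
Proof. by rewrite /rho; case: (n \in D). Qed.

Lemma lo_rho_common D (A : set (set nat)) :
  (exists z, forall S, A S -> lo (rho D) S z) ->
  exists m, forall S, A S -> S m.
Proof.
move=> [z zP]; have [[S0 AS0]|noA] := pselect (exists S, A S); last first.
  by exists 0 => S AS; case: noA; exists S.
have tagP k : computable (fun x => pairn k x).
  exact: computable_pair (computable_const k) computable_id.
have [ret retP] := tagP 0; have [ask askP] := tagP 1.
pose chi n : nat := n \notin D.
(* The test set q consists of the numbers whose outcome lies in S. The realizers [ask] and [ret]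
   serve every S, so z always gets the same argument. *)
have outS S : A S -> exists2 x,
    papp z (pairn (encode ask) (encode ret)) x & exists2 y, outcome chi x y & S y.
  move=> AS; apply: (zP S AS [set x | exists2 y, outcome chi x y & S y] I).
  exists (encode ask); last exists (encode ret) => //.
  - move=> _ [n [e [-> [B]]]]; rewrite rho_eq => /= -> /(_ _ erefl) [x ex [y xy Sy]].
    exists (pairn 1 (pairn n e)); first exact: papp_encode.
    by exists y => //; exact: outcome_query ex xy.
  - move=> y Sy; exists (pairn 0 y); first exact: papp_encode.
    by exists y => //; exact: outcome_return.
have [x zx [m xm _]] := outS _ AS0; exists m => S /outS [x' zx' [m' xm' Sm']].
have Ex := papp_functional zx zx'; subst x'.
by rewrite (outcome_functional _ _ _ _ xm xm').
Qed.

(** For S in [A], any b in [imp S q] puts <0, b> into [mo] at q; the 0 is arbitrary, the collection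
    being constant. *)
Lemma lo_unit (A : set (set nat)) :
  exists a, forall S, A S -> lo (fun=> A) S a.
Proof.
have [u uP] := universal_code.
have [c cP] : computable (fun x => pairn (fstn x) (pairn 0 (sndn x))).
  by repeat first [ apply: computable_id | apply: computable_const
    | apply: computable_pair | apply: computable_fst | apply: computable_snd ].
exists (encode (Comp u c)) => S AS q _ _ [a aP [b bP <-]].
have [y ay qy] : exists2 y, papp a (pairn 0 b) y & q y.
  by apply: aP; exists 0, b; split=> //; exists S.
exists y => //; apply: papp_encode; exists (pairn a (pairn 0 b)); last exact: uP.
by move: (cP (pairn a b)); rewrite !pairnE.
Qed.

(** [mo] of the empty collection is empty, so any number realizes the first premise and the identity
    works. *)
Lemma le_lo_set0 theta : le_lo (fun=> set0) theta.
Proof.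
have [i iP] := computable_id.
exists (encode i) => p _ e ep; exists e; first exact: papp_encode.
move=> q _ _ [a aP [b bP <-]]; apply: (ep q I); exists a; last by exists b.
  by move=> ? [? [? [_ []]]].
Qed.

Lemma common_le_lo_set0 (A : set (set nat)) m :
  (forall S, A S -> S m) -> le_lo (fun=> A) (fun=> set0).
Proof.
move=> Am; have [u uP] := universal_code.
have [c cP] : computable (fun x => pairn (sndn x) m).
  exact: computable_pair (computable_snd _ computable_id) (computable_const m).
have [d dP] : computable (fun x => pairn (encode (Comp u c)) (sndn x)).
  exact: computable_pair (computable_const _) (computable_snd _ computable_id).
(* 5 is the tag of [Comp] in [encode]: from an index e this computes an index of e composed with
   [d]. *)
have [s sP] : computable (fun e => pairn 5 (pairn e (encode d))).
  by repeat first [ apply: computable_id | apply: computable_const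
    | apply: computable_pair ].
exists (encode s) => p _ e ep.
exists (pairn 5 (pairn e (encode d))); first exact: papp_encode.
move=> q _ _ [a _ [b bP <-]].
have [y [ce <- cey] qy] :
    exists2 y, papp e (pairn (encode (Comp u c)) b) y & q y.
  apply: (ep q I); exists (encode (Comp u c)); last by exists b.
  move=> _ [n [e' [-> [S AS e'S]]]].
  have [y e'y qy] := e'S _ (Am _ AS).
  exists y => //; apply: papp_encode; exists (pairn e' m); last exact: uP.
  by move: (cP (pairn n e')); rewrite pairnE.
exists y => //; apply: (papp_encode (Comp ce d)).
exists (pairn (encode (Comp u c)) b) => //.
by move: (dP (pairn a b)); rewrite pairnE.
Qed.

Theorem proposition3p4p4 (A : set (set nat)) (D : set nat) :
  le_lo (fun _ : nat => A) (rho D) ->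
  equiv_lo (fun _ : nat => A) (fun _ : nat => set0).
Proof.
move=> [f fP]; split; last exact: le_lo_set0.
have [a aP] := lo_unit A.
suff /lo_rho_common [m Am] : exists z, forall S, A S -> lo (rho D) S z.
  exact: common_le_lo_set0 Am.
(* A member of [A] guarantees that f(a) is defined; without one, any z will do. *)
have [[S0 AS0]|noA] := pselect (exists S, A S); last first.
  by exists 0 => S AS; case: noA; exists S.
have [z fz _] := fP S0 I a (aP S0 AS0); exists z => S AS.
by have [z' fz' ?] := fP S I a (aP S AS); rewrite (papp_functional fz fz').
Qed.
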